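(* Let $F=F_n$ be the Fourier matrix of size $n$ and $\rho_F$ the associated representation of $\mathrm{Pol}(S_n^+)$ on $\mathbb{C}^n$. (i) For any $n\in\mathbb{N}$, $n\geq 1$, $$\mathcal{H}_1(\rho_F)\cong\bigoplus_{k=1}^{n-1}\mathbb{C}^{\gcd(n,k)-1},$$ where $\gcd(n,k)$ denotes the greatest common divisor of $n$ and $k$. (ii) If $n$ is a prime number, then $\mathcal{H}_1(\rho_F)=\{0\}$, and so any $\rho_F$-$\varepsilon$-cocycle is a coboundary.
   Context: $\mathrm{Pol}(S_n^+)$ is the universal unital $*$-algebra generated by $p_{ij}$ ($1\le i,j\le n$) subject to $p_{ij}=p_{ij}^*=p_{ij}^2$, $p_{ij}p_{ik}=0=p_{ji}p_{ki}$ for $j\ne k$, and $\sum_j p_{ij}=\sum_j p_{ji}=1$ for all $i$; its counit $\varepsilon$ is the character with $\varepsilon(p_{ij})=\delta_{ij}$. The Fourier matrix $F_n$ is the $n\times n$ matrix with entries $(F_n)_{lm}=e^{2\pi i(l-1)(m-1)/n}$, $1\le l,m\le n$, with rows $h_1,\ldots,h_n\in\mathbb{C}^n$. The representation $\rho_F:\mathrm{Pol}(S_n^+)\to M_n(\mathbb{C})$ is the unital $*$-homomorphism with $\rho_F(p_{jk})=\mathrm{Proj}(h_j/h_k)$, the orthogonal projection of $\mathbb{C}^n$ onto the line spanned by the entrywise quotient $h_j/h_k=(h_{jm}/h_{km})_{m=1}^n$. For a representation (unital $*$-homomorphism) $\rho:\mathrm{Pol}(S_n^+)\to B(\mathsf{h})$,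 $Z_1(\rho)$ is the vector space of all $\rho$-$\varepsilon$-cocycles, i.e. linear maps $\eta:\mathrm{Pol}(S_n^+)\to\mathsf{h}$ with $\eta(ab)=\rho(a)\eta(b)+\eta(a)\varepsilon(b)$; $B_1(\rho)$ is the subspace of 1-coboundaries, i.e. maps of the form $a\mapsto(\rho(a)-\varepsilon(a)\mathrm{id}_{\mathsf{h}})v$ with $v\in\mathsf{h}$; and $\mathcal{H}_1(\rho)=Z_1(\rho)/B_1(\rho)$. *)

(* Defs.v *)
From HB Require Import structures.
From mathcomp Require Import all_boot all_order all_algebra.
From mathcomp Require Import generic_quotient ring_quotient.
From mathcomp Require Import complex.
From mathcomp Require Import boolp functions reals trigo.
From mathcomp Require Import ring lra.

Set Implicit Arguments.
Unset Strict Implicit.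
Unset Printing Implicit Defensive.

Import Order.TTheory GRing.Theory Num.Theory.
Local Open Scope ring_scope.
Local Open Scope sesquilinear_scope.
Local Open Scope quotient_scope.

(** * Unital *-algebras and unital *-homomorphisms *)

HB.mixin Record Algebra_isStar (C : numClosedFieldType) A
    of GRing.Algebra C A := {
  star : A -> A;
  starK : involutive star;
  starD : {morph star : x y / x + y};
  starZ : forall (c : C) (x : A), star (c *: x) = c^* *: star x;
  starM : forall x y : A, star (x * y) = star y * star x
}.

#[short(type="starAlgType")]
HB.structure Definition StarAlgebra (C : numClosedFieldType) :=
  {A of GRing.Algebra C A & Algebra_isStar C A}.

HB.mixin Record isStarMorphism (C : numClosedFieldType)
    (A B : starAlgType C) (f : A -> B) := {
  rmorph_star : {morph f : x / star x}
}.

#[short(type="starMorphism")]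
HB.structure Definition StarMorphism (C : numClosedFieldType)
    (A B : starAlgType C) :=
  {f of @GRing.LRMorphism C A B *:%R f & isStarMorphism C A B f}.

Section StarInstances.
Variable C : numClosedFieldType.

Fact conj_involutive : involutive (Num.conj : C^o -> C^o).
Proof. exact: conjCK. Qed.
Fact conj_starD : {morph (Num.conj : C^o -> C^o) : x y / x + y}.
Proof. by move=> x y; rewrite rmorphD. Qed.
Fact conj_starZ (c : C) (x : C^o) : (c *: x)^* = c^* *: (x^* : C^o).
Proof. by rewrite /GRing.scale /= rmorphM. Qed.
Fact conj_starM (x y : C^o) : (x * y)^* = y^* * x^*.
Proof. by rewrite rmorphM mulrC. Qed.

HB.instance Definition _ := Algebra_isStar.Build C C^o
  conj_involutive conj_starD conj_starZ conj_starM.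

Variable n : nat.
Let adj (A : 'M[C]_n.+1) : 'M[C]_n.+1 := A ^t*.

Fact adj_involutive : involutive adj.
Proof. by move=> A; apply/matrixP=> i j; rewrite !mxE conjCK. Qed.
Fact adj_starD : {morph adj : x y / x + y}.
Proof. by move=> A B; apply/matrixP=> i j; rewrite !mxE rmorphD. Qed.
Fact adj_starZ (c : C) (A : 'M[C]_n.+1) : adj (c *: A) = c^* *: adj A.
Proof. by apply/matrixP=> i j; rewrite !mxE rmorphM. Qed.
Fact adj_starM (A B : 'M[C]_n.+1) : adj (A * B) = adj B * adj A.
Proof. by rewrite /adj trmx_mul map_mxM. Qed.

HB.instance Definition _ := Algebra_isStar.Build C 'M[C]_n.+1
  adj_involutive adj_starD adj_starZ adj_starM.

End StarInstances.

(** * The universal *-algebra Pol(S_n^+) *)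

Definition magic_unitary (C : numClosedFieldType) (n : nat)
    (B : starAlgType C) (q : 'I_n -> 'I_n -> B) : Prop :=
  [/\ forall i j, star (q i j) = q i j /\ q i j * q i j = q i j,
      forall i j k, j != k -> q i j * q i k = 0 /\ q j i * q k i = 0 &
      forall i, \sum_j q i j = 1 /\ \sum_j q j i = 1].

Module PolSnDef.
Section PolSnDef.
Variables (C : numClosedFieldType) (n : nat).

(* Formal *-algebra expressions in the generators; Pol(S_n^+) is their
   quotient by the least congruence forcing the axioms of a unital complex
   *-algebra and the defining relations. *)
Inductive term :=
  | Gen of 'I_n & 'I_n
  | Zero
  | One
  | Add of term & term
  | Scale of C & term
  | Mul of term & term
  | Star of term.

Definition sum_term (f : 'I_n -> term) : term :=
  foldr (fun j t => Add (f j) t) Zero (enum 'I_n).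

Inductive eqt : term -> term -> Prop :=
  | eqt_refl t : eqt t t
  | eqt_sym s t : eqt s t -> eqt t s
  | eqt_trans s t u : eqt s t -> eqt t u -> eqt s u
  | eqt_add s s' t t' : eqt s s' -> eqt t t' -> eqt (Add s t) (Add s' t')
  | eqt_scale c t t' : eqt t t' -> eqt (Scale c t) (Scale c t')
  | eqt_mul s s' t t' : eqt s s' -> eqt t t' -> eqt (Mul s t) (Mul s' t')
  | eqt_star t t' : eqt t t' -> eqt (Star t) (Star t')
  | eqt_addA s t u : eqt (Add s (Add t u)) (Add (Add s t) u)
  | eqt_addC s t : eqt (Add s t) (Add t s)
  | eqt_add0 t : eqt (Add Zero t) t
  | eqt_scale0 t : eqt (Scale 0 t) Zero
  | eqt_scale1 t : eqt (Scale 1 t) t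
  | eqt_scaleA c d t : eqt (Scale c (Scale d t)) (Scale (c * d) t)
  | eqt_scaleDr c s t : eqt (Scale c (Add s t)) (Add (Scale c s) (Scale c t))
  | eqt_scaleDl c d t : eqt (Scale (c + d) t) (Add (Scale c t) (Scale d t))
  | eqt_mulA s t u : eqt (Mul s (Mul t u)) (Mul (Mul s t) u)
  | eqt_mul1l t : eqt (Mul One t) t
  | eqt_mul1r t : eqt (Mul t One) t
  | eqt_mulDl s t u : eqt (Mul (Add s t) u) (Add (Mul s u) (Mul t u))
  | eqt_mulDr s t u : eqt (Mul s (Add t u)) (Add (Mul s t) (Mul s u))
  | eqt_scaleAl c s t : eqt (Scale c (Mul s t)) (Mul (Scale c s) t)
  | eqt_scaleAr c s t : eqt (Scale c (Mul s t)) (Mul s (Scale c t))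
  | eqt_starK t : eqt (Star (Star t)) t
  | eqt_starD s t : eqt (Star (Add s t)) (Add (Star s) (Star t))
  | eqt_starZ c t : eqt (Star (Scale c t)) (Scale c^* (Star t))
  | eqt_starM s t : eqt (Star (Mul s t)) (Mul (Star t) (Star s))
  | eqt_gen_star i j : eqt (Star (Gen i j)) (Gen i j)
  | eqt_gen_idem i j : eqt (Mul (Gen i j) (Gen i j)) (Gen i j)
  | eqt_gen_row i j k : j != k -> eqt (Mul (Gen i j) (Gen i k)) Zero
  | eqt_gen_col i j k : j != k -> eqt (Mul (Gen j i) (Gen k i)) Zero
  | eqt_sum_row i : eqt (sum_term (fun j => Gen i j)) One
  | eqt_sum_col i : eqt (sum_term (fun j => Gen j i)) One.

#[export]
HB.instance Definition _ := gen_eqMixin term.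
#[export]
HB.instance Definition _ := gen_choiceMixin term.

Definition eqtb (s t : term) : bool := `[< eqt s t >].

Fact eqtb_equiv : equiv_class_of eqtb.
Proof.
split=> [t|s t|t s u].
- exact/asboolP/eqt_refl.
- by apply/asboolP/asboolP; apply: eqt_sym.
- by move=> /asboolP st /asboolP tu; apply/asboolP/(eqt_trans st tu).
Qed.

Canonical eqtb_equivRel := EquivRelPack eqtb_equiv.
Canonical eqtb_encModRel := defaultEncModRel eqtb.

Definition PolSn := {eq_quot eqtb}.

#[export]
HB.instance Definition _ : EqQuotient term eqtb PolSn := EqQuotient.on PolSn.
#[export]
HB.instance Definition _ := Choice.on PolSn.

Local Notation cl := (\pi_PolSn).

Lemma eqtP s t : cl s = cl t <-> eqt s t.
Proof.
by split=> [/eqP|st]; last apply/eqP; rewrite piE /=; [move/asboolP|apply/asboolP].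
Qed.

Let rep (a : PolSn) : term := repr a.
Let repK t : eqt (rep (cl t)) t.
Proof. by apply/eqtP; rewrite reprK. Qed.

Definition zero : PolSn := cl Zero.
Definition one : PolSn := cl One.
Definition add (a b : PolSn) : PolSn := cl (Add (rep a) (rep b)).
Definition scale (c : C) (a : PolSn) : PolSn := cl (Scale c (rep a)).
Definition opp (a : PolSn) : PolSn := scale (-1) a.
Definition mul (a b : PolSn) : PolSn := cl (Mul (rep a) (rep b)).
Definition st (a : PolSn) : PolSn := cl (Star (rep a)).

Lemma pi_add s t : cl (Add s t) = add (cl s) (cl t).
Proof. by apply/eqtP/eqt_add; apply/eqt_sym/repK. Qed.
Lemma pi_scale c t : cl (Scale c t) = scale c (cl t).
Proof. by apply/eqtP/eqt_scale; apply/eqt_sym/repK. Qed.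
Lemma pi_mul s t : cl (Mul s t) = mul (cl s) (cl t).
Proof. by apply/eqtP/eqt_mul; apply/eqt_sym/repK. Qed.
Lemma pi_star t : cl (Star t) = st (cl t).
Proof. by apply/eqtP/eqt_star; apply/eqt_sym/repK. Qed.

Let piS := (=^~ pi_add, =^~ pi_scale, =^~ pi_mul, =^~ pi_star).

Lemma quotW (P : PolSn -> Prop) : (forall t, P (cl t)) -> forall a, P a.
Proof. by move=> Pcl a; rewrite -[a]reprK. Qed.

Fact addA : associative add.
Proof.
elim/quotW=> s; elim/quotW=> t; elim/quotW=> u.
by rewrite !piS; apply/eqtP/eqt_addA.
Qed.
Fact addC : commutative add.
Proof. by elim/quotW=> s; elim/quotW=> t; rewrite !piS; apply/eqtP/eqt_addC. Qed.
Fact add0 : left_id zero add.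
Proof. by elim/quotW=> t; rewrite /zero !piS; apply/eqtP/eqt_add0. Qed.
Fact addN : left_inverse zero opp add.
Proof.
elim/quotW=> t; rewrite /opp /zero !piS; apply/eqtP.
have h : eqt (Add (Scale (-1) t) t) (Add (Scale (-1) t) (Scale 1 t)).
  by apply: eqt_add; [exact: eqt_refl|exact/eqt_sym/eqt_scale1].
apply: (eqt_trans h); apply: eqt_trans (eqt_sym (eqt_scaleDl _ _ _)) _.
by rewrite addNr; apply: eqt_scale0.
Qed.
#[export]
HB.instance Definition _ := GRing.isZmodule.Build PolSn addA addC add0 addN.

Fact scaleA c d a : scale c (scale d a) = scale (c * d) a.
Proof. by elim/quotW: a => t; rewrite !piS; apply/eqtP/eqt_scaleA. Qed.
Fact scale1 : left_id 1 scale.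
Proof. by elim/quotW=> t; rewrite !piS; apply/eqtP/eqt_scale1. Qed.
Fact scaleDr : right_distributive scale +%R.
Proof.
move=> c; elim/quotW=> s; elim/quotW=> t; rewrite /GRing.add /= !piS.
exact/eqtP/eqt_scaleDr.
Qed.
Fact scaleDl a : {morph scale^~ a : c d / c + d}.
Proof.
elim/quotW: a => t c d; rewrite [RHS]/GRing.add /= !piS.
exact/eqtP/eqt_scaleDl.
Qed.
#[export]
HB.instance Definition _ :=
  GRing.Zmodule_isLmodule.Build C PolSn scaleA scale1 scaleDr scaleDl.

Fact mulA : associative mul.
Proof.
elim/quotW=> s; elim/quotW=> t; elim/quotW=> u.
by rewrite !piS; apply/eqtP/eqt_mulA.
Qed.
Fact mul_1l : left_id one mul.
Proof. by elim/quotW=> t; rewrite /one !piS; apply/eqtP/eqt_mul1l. Qed.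
Fact mul_1r : right_id one mul.
Proof. by elim/quotW=> t; rewrite /one !piS; apply/eqtP/eqt_mul1r. Qed.
Fact mulDl : left_distributive mul +%R.
Proof.
elim/quotW=> s; elim/quotW=> t; elim/quotW=> u; rewrite /GRing.add /= !piS.
exact/eqtP/eqt_mulDl.
Qed.
Fact mulDr : right_distributive mul +%R.
Proof.
elim/quotW=> s; elim/quotW=> t; elim/quotW=> u; rewrite /GRing.add /= !piS.
exact/eqtP/eqt_mulDr.
Qed.

Section Eval.
Variables (B : starAlgType C) (q : 'I_n -> 'I_n -> B).

Fixpoint eval (t : term) : B :=
  match t with
  | Gen i j => q i j
  | Zero => 0
  | One => 1
  | Add s t => eval s + eval t
  | Scale c t => c *: eval t
  | Mul s t => eval s * eval t
  | Star t => star (eval t)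
  end.

Lemma eval_sum (f : 'I_n -> term) : eval (sum_term f) = \sum_j eval (f j).
Proof.
by rewrite /sum_term -big_enum; elim: (enum _) => [|j s IH] /=;
   rewrite ?big_nil // big_cons IH.
Qed.

Hypothesis q_magic : magic_unitary q.

Lemma eval_eqt s t : eqt s t -> eval s = eval t.
Proof.
case: q_magic => q_proj q_orth q_sum.
elim=> //= {s t}.
- by move=> s t u _ -> _ ->.
- by move=> s s' t t' _ -> _ ->.
- by move=> c t t' _ ->.
- by move=> s s' t t' _ -> _ ->.
- by move=> t t' _ ->.
- by move=> *; rewrite addrA.
- by move=> *; rewrite addrC.
- by move=> *; rewrite add0r.
- by move=> *; rewrite scale0r.
- by move=> *; rewrite scale1r.
- by move=> *; rewrite scalerA.
- by move=> *; rewrite scalerDr.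
- by move=> *; rewrite scalerDl.
- by move=> *; rewrite mulrA.
- by move=> *; rewrite mul1r.
- by move=> *; rewrite mulr1.
- by move=> *; rewrite mulrDl.
- by move=> *; rewrite mulrDr.
- by move=> *; rewrite scalerAl.
- by move=> *; rewrite scalerAr.
- by move=> *; rewrite starK.
- by move=> *; rewrite starD.
- by move=> *; rewrite starZ.
- by move=> *; rewrite starM.
- by move=> i j; case: (q_proj i j).
- by move=> i j; case: (q_proj i j).
- by move=> i j k jk; case: (q_orth i j k jk).
- by move=> i j k jk; case: (q_orth i j k jk).
- by move=> i; rewrite eval_sum; case: (q_sum i).
- by move=> i; rewrite eval_sum; case: (q_sum i).
Qed.

End Eval.

Lemma delta_magic : magic_unitary (fun i j : 'I_n => (i == j)%:R : C^o).
Proof.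
split=> [i j|i j k jk|i].
- by rewrite /star /= conjC_nat; case: eqP => _; rewrite ?mulr0 ?mulr1.
- split; apply/eqP; rewrite mulf_eq0 !pnatr_eq0 !eqb0 -negb_and;
    by apply: contra jk => /andP[/eqP<- /eqP<-].
- split; rewrite (bigD1 i) //= eqxx big1 ?addr0 // => j ji.
    by rewrite eq_sym (negPf ji).
  by rewrite (negPf ji).
Qed.

Fact one_neq0 : one != 0.
Proof.
apply/eqP=> /eqtP /(eval_eqt delta_magic) /= /eqP.
by rewrite oner_eq0.
Qed.

#[export]
HB.instance Definition _ :=
  GRing.Zmodule_isNzRing.Build PolSn mulA mul_1l mul_1r mulDl mulDr one_neq0.

Fact scaleAl (c : C) (a b : PolSn) : c *: (a * b) = (c *: a) * b.
Proof.
elim/quotW: a => s; elim/quotW: b => t; rewrite /GRing.mul /GRing.scale /= !piS.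
exact/eqtP/eqt_scaleAl.
Qed.
#[export]
HB.instance Definition _ := GRing.Lmodule_isLalgebra.Build C PolSn scaleAl.

Fact scaleAr (c : C) (a b : PolSn) : c *: (a * b) = a * (c *: b).
Proof.
elim/quotW: a => s; elim/quotW: b => t; rewrite /GRing.mul /GRing.scale /= !piS.
exact/eqtP/eqt_scaleAr.
Qed.
#[export]
HB.instance Definition _ := GRing.Lalgebra_isAlgebra.Build C PolSn scaleAr.

Fact stK : involutive st.
Proof. by elim/quotW=> t; rewrite !piS; apply/eqtP/eqt_starK. Qed.
Fact stD : {morph st : x y / x + y}.
Proof.
elim/quotW=> s; elim/quotW=> t; rewrite /GRing.add /= !piS.
exact/eqtP/eqt_starD.
Qed.
Fact stZ (c : C) (x : PolSn) : st (c *: x) = c^* *: st x.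
Proof.
elim/quotW: x => t; rewrite /GRing.scale /= !piS; exact/eqtP/eqt_starZ.
Qed.
Fact stM (x y : PolSn) : st (x * y) = st y * st x.
Proof.
elim/quotW: x => s; elim/quotW: y => t; rewrite /GRing.mul /= !piS.
exact/eqtP/eqt_starM.
Qed.
#[export]
HB.instance Definition _ := Algebra_isStar.Build C PolSn stK stD stZ stM.

Definition gen (i j : 'I_n) : PolSn := cl (Gen i j).

Lemma pi_sum_term (f : 'I_n -> term) : cl (sum_term f) = \sum_j cl (f j).
Proof.
by rewrite /sum_term -big_enum; elim: (enum _) => [|j s IH] /=;
   rewrite ?big_nil // big_cons pi_add IH.
Qed.

Lemma gen_magic : magic_unitary gen.
Proof.
split=> [i j|i j k jk|i].
- split; rewrite /star /GRing.mul /= /gen !piS; apply/eqtP.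
    exact: eqt_gen_star.
  exact: eqt_gen_idem.
- split; rewrite /GRing.mul /= /gen !piS; apply/eqtP.
    exact: eqt_gen_row.
  exact: eqt_gen_col.
- split; rewrite /gen -pi_sum_term; apply/eqtP.
    exact: eqt_sum_row.
  exact: eqt_sum_col.
Qed.

Section Lift.
Variables (B : starAlgType C) (q : 'I_n -> 'I_n -> B).

Definition lift of magic_unitary q := fun a : PolSn => eval q (rep a).

Hypothesis q_magic : magic_unitary q.
Local Notation f := (lift q_magic).

Lemma liftE t : f (cl t) = eval q t.
Proof. exact: (eval_eqt q_magic (repK t)). Qed.

Fact lift_monoid_morphism : monoid_morphism f.
Proof.
split; first exact: (liftE One).
elim/quotW=> s; elim/quotW=> t.
by rewrite [in LHS]/GRing.mul /= !piS !liftE.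
Qed.

Fact lift_linear : linear f.
Proof.
move=> c; elim/quotW=> s; elim/quotW=> t.
by rewrite [in LHS]/GRing.add /= [in LHS]/GRing.scale /= !piS !liftE.
Qed.

Fact lift_star : {morph f : x / star x}.
Proof. by elim/quotW=> t; rewrite [in LHS]/star /= !piS !liftE. Qed.

#[export]
HB.instance Definition _ := GRing.isLinear.Build C PolSn B _ f lift_linear.
#[export]
HB.instance Definition _ :=
  GRing.isMonoidMorphism.Build PolSn B f lift_monoid_morphism.
#[export]
HB.instance Definition _ := isStarMorphism.Build C PolSn B f lift_star.

End Lift.
End PolSnDef.
Module Exports. HB.reexport. End Exports.
End PolSnDef.
Export PolSnDef.Exports.

(** * Direct sums and quotients of modules *)

Section Misc.
Variable (R : pzRingType).

(* As I is finite, the direct sum is the full product with pointwise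
   operations. *)
Definition dirsum (I : finType) (V : I -> lmodType R) := {dffun forall i, V i}.

Section Dirsum.
Variables (I : finType) (V : I -> lmodType R).
Local Notation D := (dirsum V).

HB.instance Definition _ := Choice.on D.

Let zero : D := [ffun i => 0].
Let add (x y : D) : D := [ffun i => x i + y i].
Let opp (x : D) : D := [ffun i => - x i].
Let scale (c : R) (x : D) : D := [ffun i => c *: x i].

Fact dirsum_addA : associative add.
Proof. by move=> x y z; apply/ffunP=> i; rewrite !ffunE addrA. Qed.
Fact dirsum_addC : commutative add.
Proof. by move=> x y; apply/ffunP=> i; rewrite !ffunE addrC. Qed.
Fact dirsum_add0 : left_id zero add.
Proof. by move=> x; apply/ffunP=> i; rewrite !ffunE add0r. Qed.
Fact dirsum_addN : left_inverse zero opp add.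
Proof. by move=> x; apply/ffunP=> i; rewrite !ffunE addNr. Qed.
HB.instance Definition _ := GRing.isZmodule.Build D
  dirsum_addA dirsum_addC dirsum_add0 dirsum_addN.

Fact dirsum_scaleA c d x : scale c (scale d x) = scale (c * d) x.
Proof. by apply/ffunP=> i; rewrite !ffunE scalerA. Qed.
Fact dirsum_scale1 : left_id 1 scale.
Proof. by move=> x; apply/ffunP=> i; rewrite !ffunE scale1r. Qed.
Fact dirsum_scaleDr : right_distributive scale +%R.
Proof. by move=> c x y; apply/ffunP=> i; rewrite !ffunE scalerDr. Qed.
Fact dirsum_scaleDl x : {morph scale^~ x : c d / c + d}.
Proof. by move=> c d; apply/ffunP=> i; rewrite !ffunE scalerDl. Qed.
HB.instance Definition _ := GRing.Zmodule_isLmodule.Build R D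
  dirsum_scaleA dirsum_scale1 dirsum_scaleDr dirsum_scaleDl.

End Dirsum.

Fact submod_zmod_closed (V : lmodType R) (W : submodClosed V) : zmod_closed W.
Proof.
by split=> [|u v Wu Wv]; rewrite ?rpred0 // -scaleN1r rpredD ?rpredZ.
Qed.

Definition submod_zmod (V : lmodType R) (W : submodClosed V) : zmodClosed V :=
  HB.pack_for (zmodClosed V) (GRing.SubmodClosed.sort W)
    (GRing.isZmodClosed.Build V (GRing.SubmodClosed.sort W) (submod_zmod_closed W)).

Definition quot_lmod (V : lmodType R) (W : submodClosed V) :=
  {ideal_quot (submod_zmod W)}.

Section QuotLmod.
Variables (V : lmodType R) (W : submodClosed V).
Local Notation Q := (quot_lmod W).

HB.instance Definition _ := GRing.Zmodule.on Q.

Definition quot_pi (v : V) : Q := \pi_{ideal_quot (submod_zmod W)} v.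

Lemma quot_piP (u v : V) : quot_pi u = quot_pi v <-> u - v \in W.
Proof.
rewrite -[u - v \in W]/(u - v \in submod_zmod W) Quotient.idealrBE.
by split=> [/eqP|/eqP].
Qed.

Let scale (c : R) (x : Q) : Q := quot_pi (c *: repr x).

Let pi_scale c v : scale c (quot_pi v) = quot_pi (c *: v).
Proof. by apply/quot_piP; rewrite -scalerBr rpredZ //; apply/quot_piP; exact: reprK. Qed.
Let pi_add u v : quot_pi (u + v) = quot_pi u + quot_pi v.
Proof. exact: Quotient.pi_add. Qed.
Let quotW (P : Q -> Prop) : (forall v, P (quot_pi v)) -> forall x, P x.
Proof. by move=> Ppi x; rewrite -[x]reprK; apply: Ppi. Qed.

Fact quot_scaleA c d x : scale c (scale d x) = scale (c * d) x.
Proof. by elim/quotW: x => v; rewrite !pi_scale scalerA. Qed.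
Fact quot_scale1 : left_id 1 scale.
Proof. by elim/quotW=> v; rewrite pi_scale scale1r. Qed.
Fact quot_scaleDr : right_distributive scale +%R.
Proof.
move=> c; elim/quotW=> u; elim/quotW=> v.
by rewrite -pi_add !pi_scale scalerDr pi_add.
Qed.
Fact quot_scaleDl x : {morph scale^~ x : c d / c + d}.
Proof. by elim/quotW: x => v c d; rewrite !pi_scale scalerDl pi_add. Qed.
HB.instance Definition _ := GRing.Zmodule_isLmodule.Build R Q
  quot_scaleA quot_scale1 quot_scaleDr quot_scaleDl.

Fact quot_pi_linear : linear quot_pi.
Proof. by move=> c u v; rewrite pi_add -pi_scale. Qed.
HB.instance Definition _ := GRing.isLinear.Build R V Q _ quot_pi quot_pi_linear.

End QuotLmod.
End Misc.

Definition lmod_isomorphic (R : pzRingType) (U V : lmodType R) : Prop :=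
  exists f : {linear U -> V}, bijective f.

(** * Pol(S_n^+), its counit and its first cohomology *)

Notation Pol_Snp := PolSnDef.PolSn.

Section Cohomology.
Variables (C : numClosedFieldType) (n : nat).
Local Notation A := (Pol_Snp C n).

Definition pgen (i j : 'I_n) : A := PolSnDef.gen C i j.

Lemma pgen_magic : magic_unitary pgen.
Proof. exact: PolSnDef.gen_magic. Qed.

Definition pol_lift (B : starAlgType C) (q : 'I_n -> 'I_n -> B)
    (hq : magic_unitary q) : starMorphism A B := PolSnDef.lift hq.

Lemma pol_lift_gen (B : starAlgType C) (q : 'I_n -> 'I_n -> B)
  (hq : magic_unitary q) i j : pol_lift hq (pgen i j) = q i j.
Proof. exact: (PolSnDef.liftE hq). Qed.

Lemma pol_lift_uniq (B : starAlgType C) (f g : starMorphism A B) :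
  (forall i j, f (pgen i j) = g (pgen i j)) -> f =1 g.
Proof.
move=> fg; apply: PolSnDef.quotW; elim=> [i j|||s fs t ft|c t ft|s fs t ft|t ft].
- exact: fg.
- by rewrite [LHS](raddf0 f) [RHS](raddf0 g).
- by rewrite [LHS](rmorph1 f) [RHS](rmorph1 g).
- by rewrite PolSnDef.pi_add [LHS](raddfD f) [RHS](raddfD g); congr (_ + _).
- by rewrite PolSnDef.pi_scale [LHS](linearZZ f) [RHS](linearZZ g); congr (_ *: _).
- by rewrite PolSnDef.pi_mul [LHS](rmorphM f) [RHS](rmorphM g); congr (_ * _).
- by rewrite PolSnDef.pi_star [LHS](@rmorph_star _ _ _ f) [RHS](@rmorph_star _ _ _ g);
    congr star.
Qed.

Definition counit : starMorphism A C^o := pol_lift (PolSnDef.delta_magic C n).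

Lemma counit_gen i j : counit (pgen i j) = (i == j)%:R.
Proof. exact: pol_lift_gen. Qed.

Variables (m : nat) (rho : starMorphism A 'M[C]_m.+1).

Definition is_cocycle (eta : A -> 'cV[C]_m.+1) : Prop :=
  linear eta /\
  forall a b, eta (a * b) = rho a *m eta b + counit b *: eta a.

Definition is_coboundary (eta : A -> 'cV[C]_m.+1) : Prop :=
  exists v : 'cV[C]_m.+1, forall a, eta a = (rho a - (counit a)%:M) *m v.

Lemma coboundary_cocycle eta : is_coboundary eta -> is_cocycle eta.
Proof.
case=> v etaE.
have {}etaE a : eta a = rho a *m v - counit a *: v.
  by rewrite etaE mulmxBl mul_scalar_mx.
split=> [c a b|a b]; rewrite !etaE.
  rewrite (linearP rho) (linearP counit) mulmxDl -scalemxAl scalerDl -scalerA.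
  by rewrite scalerBr opprD addrACA.
rewrite (rmorphM rho) (rmorphM counit) -[_ * _]/(_ *m _) mulmxBr -scalemxAr.
by rewrite scalerBr scalerA [counit b * _]mulrC mulmxA addrA subrK.
Qed.

Definition cocycle : {pred A -> 'cV[C]_m.+1} := fun eta => `[< is_cocycle eta >].

Fact cocycle_submod : submod_closed cocycle.
Proof.
have E0 a : (0 : A -> 'cV[C]_m.+1) a = 0 by [].
split=> [|c f g /asboolP[fL fM] /asboolP[gL gM]]; apply/asboolP; split.
- by move=> c a b; rewrite !E0 scaler0 addr0.
- by move=> a b; rewrite !E0 mulmx0 scaler0 addr0.
- move=> d a b; rewrite !fctE fL gL !scalerDr !scalerA [c * d]mulrC.
  by rewrite addrACA.
- move=> a b; rewrite !fctE fM gM !scalerDr mulmxDr -scalemxAr !scalerA.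
  by rewrite [c * _]mulrC addrACA.
Qed.
HB.instance Definition _ := GRing.isSubmodClosed.Build C (A -> 'cV[C]_m.+1)
  cocycle (GRing.submod_closed_semi cocycle_submod).

Definition Z1 := {eta : A -> 'cV[C]_m.+1 | cocycle eta}.
HB.instance Definition _ := SubChoice.on Z1.
HB.instance Definition _ := [SubChoice_isSubLmodule of Z1 by <:].

Definition B1 : {pred Z1} := fun eta => `[< is_coboundary (val eta) >].

Fact B1_submod : submod_closed B1.
Proof.
split=> [|c f g /asboolP[v fv] /asboolP[w gw]]; apply/asboolP.
  by exists 0 => a; rewrite mulmx0.
exists (c *: v + w) => a.
by rewrite mulmxDr -scalemxAr -fv -gw.
Qed.
HB.instance Definition _ := GRing.isSubmodClosed.Build C Z1
  B1 (GRing.submod_closed_semi B1_submod).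

Definition H1 := quot_lmod B1.
HB.instance Definition _ := GRing.Lmodule.on H1.

End Cohomology.
Arguments B1 {C n m} rho.

(** * The Fourier matrix and its representation *)

Section Hadamard.
Variables (C : numClosedFieldType) (n : nat).
Implicit Types (v w : 'cV[C]_n.+1) (F : 'M[C]_n.+1).

Definition Proj v : 'M[C]_n.+1 := ((v ^t* *m v) 0 0)^-1 *: (v *m v ^t*).

Let dot_mx v w : v ^t* *m w = ((v ^t* *m w) 0 0)%:M.
Proof. exact: mx11_scalar. Qed.

Let nrm_real v : ((v ^t* *m v) 0 0)^* = (v ^t* *m v) 0 0.
Proof.
rewrite !mxE rmorph_sum; apply: eq_bigr => i _.
by rewrite !mxE rmorphM /= conjCK mulrC.
Qed.

Lemma dot_neq0 v : v != 0 -> (v ^t* *m v) 0 0 != 0.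
Proof.
apply: contra => /eqP; rewrite mxE => /eqP.
rewrite psumr_eq0; last by move=> i _; rewrite !mxE mulrC mul_conjC_ge0.
move=> /allP v0; apply/eqP/matrixP=> i j; rewrite !ord1 !mxE.
have /= := v0 i (mem_index_enum _); rewrite !mxE mulrC mul_conjC_eq0.
by move/eqP.
Qed.

Lemma Proj_herm v : (Proj v) ^t* = Proj v.
Proof.
rewrite /Proj; move: (nrm_real v); move: ((v ^t* *m v) 0 0) => s sJ.
apply/matrixP=> i j; rewrite !(mxE, big_ord1) rmorphM fmorphV /= sJ.
by rewrite rmorphM /= conjCK [_^* * _]mulrC.
Qed.

Lemma Proj_mul v w :
  Proj v *m Proj w = (((v ^t* *m v) 0 0)^-1 * ((w ^t* *m w) 0 0)^-1 *
                      (v ^t* *m w) 0 0) *: (v *m w ^t*).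
Proof.
have E : (v *m v ^t*) *m (w *m w ^t*) = (v ^t* *m w) 0 0 *: (v *m w ^t*).
  by rewrite mulmxA -[v *m _ *m w]mulmxA [in LHS]dot_mx mul_mx_scalar -scalemxAl.
by rewrite /Proj -scalemxAl -scalemxAr E !scalerA.
Qed.

Lemma Proj_idem v : v != 0 -> Proj v *m Proj v = Proj v.
Proof. by move=> v0; rewrite Proj_mul mulfVK ?dot_neq0. Qed.

Lemma Proj_range v w : v != 0 -> Proj v *m w = w <-> exists c, w = c *: v.
Proof.
have E u : v *m v ^t* *m u = (v ^t* *m u) 0 0 *: v.
  by rewrite -mulmxA [in LHS]dot_mx mul_mx_scalar.
move=> v0; rewrite /Proj -scalemxAl; split=> [<-|[c ->]].
  by rewrite E scalerA; eexists.
by rewrite -scalemxAr E !scalerA mulrAC mulVf ?mul1r // dot_neq0.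
Qed.

Definition row_quotient F (j k : 'I_n.+1) : 'cV[C]_n.+1 :=
  \col_m (F j m / F k m).

Lemma hadamard_magic F :
    (forall l m, F l m * (F l m)^* = 1) -> F *m F ^t* = n.+1%:R%:M ->
  magic_unitary (fun j k => Proj (row_quotient F j k)).
Proof.
move=> F1 FF.
have N0 : n.+1%:R != 0 :> C by rewrite pnatr_eq0.
have Fn0 l m : F l m != 0.
  by apply/eqP=> F0; move: (F1 l m); rewrite F0 mul0r => /esym/eqP; rewrite oner_eq0.
have Fi l m : (F l m)^-1 = (F l m)^*.
  by rewrite -[RHS]mul1r -(mulVf (Fn0 l m)) -mulrA F1 mulr1.
have rowE j k : \sum_m F j m * (F k m)^* = n.+1%:R *+ (j == k).
  move/matrixP/(_ j k): FF; rewrite !mxE => <-.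
  by apply: eq_bigr => m _; rewrite !mxE.
have FtF : F ^t* *m F = n.+1%:R%:M.
  have /mulmx1C : (n.+1%:R^-1 *: F) *m F ^t* = 1%:M.
    by rewrite -scalemxAl FF scale_scalar_mx mulVf.
  rewrite -scalemxAr => /(congr1 ( *:%R n.+1%:R)).
  by rewrite scalerA mulfV // scale1r scale_scalar_mx mulr1.
have colE l m : \sum_k (F k l)^* * F k m = n.+1%:R *+ (l == m).
  move/matrixP/(_ l m): FtF; rewrite !mxE => <-.
  by apply: eq_bigr => k _; rewrite !mxE.
have dotE j k j' k' : ((row_quotient F j k) ^t* *m row_quotient F j' k') 0 0 =
    \sum_m (F j m)^* * F k m * (F j' m * (F k' m)^*).
  rewrite mxE; apply: eq_bigr => m _.
  by rewrite !mxE !Fi rmorphM /= conjCK.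
have nrmE j k : ((row_quotient F j k) ^t* *m row_quotient F j k) 0 0 = n.+1%:R.
  rewrite dotE (eq_bigr (fun=> 1)) ?sumr_const ?card_ord // => m _.
  by rewrite mulrACA [(F j m)^* * _]mulrC !F1 mulr1.
have r0 j k : row_quotient F j k != 0.
  apply/eqP=> r0; move/eqP: (nrmE j k).
  by rewrite r0 mulmx0 mxE eq_sym (negPf N0).
have PE j k l m : Proj (row_quotient F j k) l m =
    n.+1%:R^-1 * (F j l * (F k l)^* * ((F j m)^* * F k m)).
  by rewrite mxE nrmE mxE big_ord1 !mxE !Fi rmorphM /= conjCK.
have cE (l m : 'I_n.+1) : (n.+1%:R^-1 * (n.+1%:R *+ (l == m)) : C) = (l == m)%:R.
  by case: eqP => _; rewrite ?mulr0 ?mulr1n ?mulVf.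
split=> [j k|j k l kl|j].
- by split; [exact: Proj_herm | exact: Proj_idem].
- have s1 : \sum_m (F j m)^* * F k m * (F j m * (F l m)^*) = 0.
    rewrite (eq_bigr (fun m => F k m * (F l m)^*)) ?rowE ?(negPf kl) // => m _.
    by rewrite mulrACA [_ * F j m]mulrC F1 mul1r.
  have s2 : \sum_m (F k m)^* * F j m * (F l m * (F j m)^*) = 0.
    rewrite (eq_bigr (fun m => F l m * (F k m)^*)) => [|m _].
      by rewrite rowE eq_sym (negPf kl).
    by rewrite mulrACA F1 mulr1 mulrC.
  by split; rewrite -[_ * _]/(_ *m _) Proj_mul ?(dotE j k j l, dotE k j l j)
    ?(s1, s2) mulr0 scale0r.
- split; apply/matrixP=> l m; rewrite summxE mxE.
    rewrite (eq_bigr (fun k => n.+1%:R^-1 * (F j l * (F j m)^*) *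
       ((F k l)^* * F k m))); last first.
      by move=> k _; rewrite PE mulrACA !mulrA.
    rewrite -mulr_sumr colE mulrAC cE; case: eqP => [->|_]; rewrite ?mul0r //.
    by rewrite F1 mulr1.
  rewrite (eq_bigr (fun k => n.+1%:R^-1 * ((F j l)^* * F j m) *
     ((F k m)^* * F k l))); last first.
    by move=> k _; rewrite PE; ring.
  rewrite -mulr_sumr colE mulrAC eq_sym cE; case: eqP => [->|_]; rewrite ?mul0r //.
  by rewrite mulrC [_^* * _]mulrC F1 mulr1.
Qed.

End Hadamard.

Section Fourier.
Variables (R : realType) (n : nat).
Local Notation C := (R[i]%C).

Definition expi (t : R) : C := (cos t +i* sin t)%C.

(* Size n.+1 makes the size positive, and ordinals start at 0, so row l here is
   row l + 1 in the 1-based convention. *)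
Definition fourier_mx : 'M[C]_n.+1 :=
  \matrix_(l, m) expi (2 * pi * l%:R * m%:R / n.+1%:R).

Let expiD s t : expi (s + t) = expi s * expi t.
Proof.
by rewrite /expi cosD sinD; apply/eqP; rewrite eq_complex /= [cos s * _ + _]addrC
  eqxx [sin s * _ + _]addrC [cos s * _]mulrC [sin s * _]mulrC ?eqxx.
Qed.
Let expi0 : expi 0 = 1.
Proof. by rewrite /expi cos0 sin0. Qed.
Let expiJ t : (expi t)^* = expi (- t).
Proof. by rewrite /expi cosN sinN. Qed.
Let expiMn t m : expi (t * m%:R) = expi t ^+ m.
Proof.
elim: m => [|m IH]; first by rewrite mulr0 expi0.
by rewrite -natr1 mulrDr mulr1 expiD IH exprSr.
Qed.

Lemma fourier_unimodular l m : fourier_mx l m * (fourier_mx l m)^* = 1.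
Proof. by rewrite mxE expiJ -expiD subrr expi0. Qed.

Lemma fourier_hadamard : fourier_mx *m fourier_mx ^t* = n.+1%:R%:M.
Proof.
have N0 : n.+1%:R != 0 :> R by rewrite pnatr_eq0.
have N_gt0 : 0 < n.+1%:R :> R by rewrite ltr0n.
apply/matrixP=> j k; rewrite !mxE.
have [<-|jk] := eqVneq j k.
  rewrite (eq_bigr (fun=> 1)) ?sumr_const ?card_ord // => m _.
  by rewrite !mxE expiJ -expiD subrr expi0.
pose x : R := pi * (j%:R - k%:R) / n.+1%:R.
have xE m : fourier_mx j m * (fourier_mx ^t*) m k = expi (x *+ 2) ^+ m.
  rewrite !mxE expiJ -expiD -expiMn; congr expi.
  by rewrite /x mulr2n; field; rewrite nat1r.
under eq_bigr do rewrite xE.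
have zN : expi (x *+ 2) ^+ n.+1 = 1.
  rewrite -expiMn; have -> : x *+ 2 * n.+1%:R = (j%:R - k%:R) * (pi *+ 2) :> R.
    by rewrite /x !mulr2n; field; rewrite nat1r.
  have e2 : expi (pi *+ 2) = 1 by rewrite /expi cos2pi sin2pi.
  by rewrite mulrC mulrBr expiD -expiJ !expiMn e2 !expr1n conjC1 mulr1.
have z1 : expi (x *+ 2) != 1.
  apply/eqP=> /(congr1 (@complex.Re R)) /=.
  rewrite cos_mulr2n cos2sin2 => h.
  have {h} /eqP : sin x ^+ 2 = 0 by move: h; rewrite mulr2n; lra.
  rewrite sqrf_eq0 => /eqP sx.
  have xpi : `|x| < pi.
    rewrite /x !normrM (gtr0_norm (pi_gt0 R)) normfV (gtr0_norm N_gt0).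
    rewrite -mulrA gtr_pMr ?pi_gt0 // ltr_pdivrMr // mul1r ltr_norml.
    have := ltn_ord j; have := ltn_ord k; rewrite -!(ltr_nat R) => hk hj.
    have := ler0n R j; have := ler0n R k; lra.
  have x0 : x != 0.
    apply: mulf_neq0; last by rewrite invr_eq0.
    apply: mulf_neq0; first by rewrite gt_eqF ?pi_gt0.
    by rewrite subr_eq0 eqr_nat; exact: jk.
  have sa : sin `|x| = 0.
    by case: (ger0P x) => _; rewrite ?sinN sx ?oppr0.
  by have := @sin_gt0_pi R `|x|; rewrite normr_gt0 x0 xpi sa ltxx => /(_ isT).
have /eqP := subrX1 (expi (x *+ 2)) n.+1.
rewrite zN subrr eq_sym mulf_eq0 subr_eq0 (negPf z1) /= => /eqP.
by move=> ->.
Qed.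

Definition rho_fourier : starMorphism (Pol_Snp C n.+1) 'M[C]_n.+1 :=
  pol_lift (hadamard_magic fourier_unimodular fourier_hadamard).

Lemma rho_fourier_gen j k :
  rho_fourier (pgen C j k) = Proj (row_quotient fourier_mx j k).
Proof. exact: pol_lift_gen. Qed.

End Fourier.

(* Main.v *)
From HB Require Import structures.
Require Import Defs.
From mathcomp Require Import all_boot all_order all_algebra.
From mathcomp Require Import complex boolp functions reals trigo ring.

(** Write N for the size of the Fourier matrix and index rows by Z/N.  Since
    h_j / h_k = h_(j - k), the projections rho_F(p_jk) depend only on j - k and
    project onto the vectors of one orthogonal basis, the rows of F.  So rho_F
    is diagonal in that basis: the coordinate of index e carries the character
    p_jk |-> [j - k = e], which is evaluation at a translation of Z/N, and a
    cocycle splits into N scalar ones.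

    Let y_jk be the coordinate of index e of the value at p_jk of a cocycle.
    The relations p_jk^2 = p_jk and p_ij p_ik = 0 force
    y_jk = ([j = k] - [j - k = e]) a_j with a_j = y_jj ([coord_cocycle]), and
    p_ji p_ki = 0 forces a_(j + e) = a_j ([coord_cocycle_period]).  Conversely
    every such a, zero for e = 0, comes from a cocycle ([periodic_cocycle]).  A
    coboundary is the case where a is constant in j.  The orbits of translation
    by e on Z/N are the classes modulo gcd(N, e) ([periodic_gcd]), so modulo
    constants the coordinate of index e contributes a space of dimension
    gcd(N, e) - 1 when e is not 0, and nothing when e = 0.  The isomorphism
    [jumps] records the gcd(N, e) - 1 differences a_r - a_0, 0 < r < gcd(N, e).

    The converse direction needs cocycles with prescribed values on generators,
    although Pol(S_n^+) only has a universal property for *-homomorphisms.  A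
    cocycle eta is therefore put into the *-homomorphism
    a |-> (rho(a), eta(a); eta(a^* )^*, epsilon(a)) with values in 2 x 2 block
    matrices where products of two off-diagonal blocks are discarded; this
    target is the algebra [sqz], and the construction is [cocycle_of_gens]. *)

Set Implicit Arguments.
Unset Strict Implicit.
Unset Printing Implicit Defensive.

Import Order.TTheory GRing.Theory Num.Theory.
Local Open Scope ring_scope.
Local Open Scope sesquilinear_scope.

(** * Star algebras *)

Section StarTheory.
Variables (C : numClosedFieldType) (A : starAlgType C).

Lemma star0 : star (0 : A) = 0.
Proof. by rewrite -[X in star X](scale0r 0) starZ conjC0 scale0r. Qed.

Lemma star1 : star (1 : A) = 1.
Proof. by rewrite -[RHS]starK -[star 1]mulr1 starM starK mulr1. Qed.

Lemma star_sum (I : finType) (F : I -> A) :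
  star (\sum_i F i) = \sum_i star (F i).
Proof. exact: (big_morph star (@starD C A) star0). Qed.
End StarTheory.

Section StarComp.
Variables (C : numClosedFieldType) (A B D : starAlgType C).
Variables (g : starMorphism B D) (f : starMorphism A B).
Fact comp_star : {morph g \o f : x / star x}.
Proof. by move=> x /=; rewrite !rmorph_star. Qed.
HB.instance Definition _ := isStarMorphism.Build C A D (g \o f) comp_star.
End StarComp.

Lemma adjmxK (C : numClosedFieldType) k l (M : 'M[C]_(k, l)) : M ^t* ^t* = M.
Proof. by apply/matrixP=> i j; rewrite !mxE conjCK. Qed.

(** * Square-zero extensions *)

Section SquareZero.
Variables (C : numClosedFieldType) (m : nat).

(** The quadruple (A, u, w, c) stands for the block matrix with rows A, u and
    w, c.  The column and row blocks multiply to zero, so the diagonal blocks of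
    a product ignore them.  Both are kept because the adjoint exchanges them:
    the image of a self-adjoint generator must itself be self-adjoint. *)
Definition sqz : Type :=
  ('M[C]_m.+1 * 'cV[C]_m.+1 * 'rV[C]_m.+1 * C^o)%type.

HB.instance Definition _ := GRing.Lmodule.copy sqz
  ('M[C]_m.+1 * 'cV[C]_m.+1 * 'rV[C]_m.+1 * C^o)%type.

Definition sqz_mx (x : sqz) : 'M[C]_m.+1 := x.1.1.1.
Definition sqz_col (x : sqz) : 'cV[C]_m.+1 := x.1.1.2.
Definition sqz_row (x : sqz) : 'rV[C]_m.+1 := x.1.2.
Definition sqz_scal (x : sqz) : C^o := x.2.
Arguments sqz_mx / x.
Arguments sqz_col / x.
Arguments sqz_row / x.
Arguments sqz_scal / x.

Lemma sqzP (x y : sqz) :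
  sqz_mx x = sqz_mx y -> sqz_col x = sqz_col y ->
  sqz_row x = sqz_row y -> sqz_scal x = sqz_scal y -> x = y.
Proof. by case: x y => [[[A u] w] c] [[[B v] z] d] /= -> -> -> ->. Qed.

Let one : sqz := (1, 0, 0, 1).
Let mul (x y : sqz) : sqz :=
  (sqz_mx x * sqz_mx y,
   sqz_mx x *m sqz_col y + sqz_scal y *: sqz_col x,
   sqz_row x *m sqz_mx y + sqz_scal x *: sqz_row y,
   sqz_scal x * sqz_scal y).
Let adj (x : sqz) : sqz :=
  (star (sqz_mx x), (sqz_row x)^t*, (sqz_col x)^t*, (sqz_scal x)^*).

Let scal_comm (c d : C^o) : c * d = d * c. Proof. exact: mulrC. Qed.

Fact sqz_mulA : associative mul.
Proof.
move=> x y z; apply: sqzP => /=; rewrite ?mulrA //.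
  rewrite mulmxDr !mulmxA -scalemxAr scalerDr !scalerA addrA.
  by rewrite [_ * sqz_scal y]scal_comm.
by rewrite mulmxDl scalerDr -!scalemxAl !mulmxA scalerA addrA.
Qed.
Fact sqz_mul1 : left_id one mul.
Proof.
move=> x; apply: sqzP; rewrite /= ?mul1r //.
  by rewrite mul1mx scaler0 addr0.
by rewrite mul0mx scale1r add0r.
Qed.
Fact sqz_mulr1 : right_id one mul.
Proof.
move=> x; apply: sqzP; rewrite /= ?mulr1 //.
  by rewrite mulmx0 scale1r add0r.
by rewrite mulmx1 scaler0 addr0.
Qed.
Fact sqz_mulDl : left_distributive mul +%R.
Proof.
move=> x y z; apply: sqzP; rewrite /= ?mulrDl //.
  by rewrite mulmxDl scalerDr addrACA.
by rewrite mulmxDl scalerDl addrACA.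
Qed.
Fact sqz_mulDr : right_distributive mul +%R.
Proof.
move=> x y z; apply: sqzP; rewrite /= ?mulrDr //.
  by rewrite mulmxDr scalerDl addrACA.
by rewrite mulmxDr scalerDr addrACA.
Qed.
Fact sqz_one_neq0 : one != 0.
Proof. by apply/eqP=> /(congr1 sqz_scal) /eqP; rewrite oner_eq0. Qed.
HB.instance Definition _ := GRing.Zmodule_isNzRing.Build sqz
  sqz_mulA sqz_mul1 sqz_mulr1 sqz_mulDl sqz_mulDr sqz_one_neq0.

Fact sqz_scaleAl (c : C) (x y : sqz) : c *: (x * y) = (c *: x) * y.
Proof.
apply: sqzP; rewrite /= ?scalerAl //.
  by rewrite scalerDr scalemxAl !scalerA [c * _]mulrC.
by rewrite scalerDr -scalemxAl scalerA.
Qed.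
HB.instance Definition _ := GRing.Lmodule_isLalgebra.Build C sqz sqz_scaleAl.

Fact sqz_scaleAr (c : C) (x y : sqz) : c *: (x * y) = x * (c *: y).
Proof.
apply: sqzP; rewrite /= ?scalerAr //.
  by rewrite scalerDr scalemxAr !scalerA.
by rewrite scalerDr -scalemxAr !scalerA [c * _]mulrC.
Qed.
HB.instance Definition _ := GRing.Lalgebra_isAlgebra.Build C sqz sqz_scaleAr.

Fact sqz_adjK : involutive adj.
Proof. by move=> x; apply: sqzP; rewrite /= ?starK ?trmxCK ?conjCK. Qed.
Fact sqz_adjD : {morph adj : x y / x + y}.
Proof.
move=> x y; apply: sqzP => /=.
- exact: (@starD C _ (sqz_mx x) (sqz_mx y)).
- by apply/matrixP=> i j; rewrite !mxE rmorphD.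
- by apply/matrixP=> i j; rewrite !mxE rmorphD.
- exact: rmorphD.
Qed.
Fact sqz_adjZ (c : C) (x : sqz) : adj (c *: x) = c^* *: adj x.
Proof.
apply: sqzP => /=.
- exact: starZ.
- by apply/matrixP=> i j; rewrite !mxE rmorphM.
- by apply/matrixP=> i j; rewrite !mxE rmorphM.
- exact: rmorphM.
Qed.
Fact sqz_adjM (x y : sqz) : adj (x * y) = adj y * adj x.
Proof.
apply: sqzP => /=.
- exact: starM.
- by rewrite linearD linearZ /= map_mxD map_mxZ trmx_mul map_mxM.
- by rewrite linearD linearZ /= map_mxD map_mxZ trmx_mul map_mxM.
- by rewrite rmorphM mulrC.
Qed.
HB.instance Definition _ := Algebra_isStar.Build C sqz
  sqz_adjK sqz_adjD sqz_adjZ sqz_adjM.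

Fact sqz_mx_linear : linear sqz_mx. Proof. by []. Qed.
Fact sqz_mx_monoid : monoid_morphism sqz_mx. Proof. by []. Qed.
Fact sqz_mx_star : {morph sqz_mx : x / star x}. Proof. by []. Qed.
HB.instance Definition _ :=
  GRing.isLinear.Build C sqz 'M[C]_m.+1 _ sqz_mx sqz_mx_linear.
HB.instance Definition _ :=
  GRing.isMonoidMorphism.Build sqz 'M[C]_m.+1 sqz_mx sqz_mx_monoid.
HB.instance Definition _ :=
  isStarMorphism.Build C sqz 'M[C]_m.+1 sqz_mx sqz_mx_star.

Fact sqz_scal_linear : linear sqz_scal. Proof. by []. Qed.
Fact sqz_scal_monoid : monoid_morphism sqz_scal. Proof. by []. Qed.
Fact sqz_scal_star : {morph sqz_scal : x / star x}. Proof. by []. Qed.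
HB.instance Definition _ :=
  GRing.isLinear.Build C sqz C^o _ sqz_scal sqz_scal_linear.
HB.instance Definition _ :=
  GRing.isMonoidMorphism.Build sqz C^o sqz_scal sqz_scal_monoid.
HB.instance Definition _ :=
  isStarMorphism.Build C sqz C^o sqz_scal sqz_scal_star.

Lemma sqz_col_linear : linear sqz_col. Proof. by []. Qed.

(** The product rule that turns the column component of a homomorphism into
    [sqz] into a cocycle. *)
Lemma sqz_colM (x y : sqz) :
  sqz_col (x * y) = sqz_mx x *m sqz_col y + sqz_scal y *: sqz_col x.
Proof. by []. Qed.
End SquareZero.
Arguments sqz_mx {C m} x /.
Arguments sqz_col {C m} x /.
Arguments sqz_row {C m} x /.
Arguments sqz_scal {C m} x /.

(** * Cocycles on Pol(S_n^+) and their values on the generators *)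

Section Cocycles.
Variables (C : numClosedFieldType) (n m : nat).
Local Notation A := (Pol_Snp C n).
Variable rho : starMorphism A 'M[C]_m.+1.

(** The elements a such that the cocycle kills both a and a^* form a unital
    *-subalgebra; asking for both is what makes the set stable under star. *)
Lemma cocycle_eq0 (eta : A -> 'cV[C]_m.+1) : is_cocycle rho eta ->
  (forall i j, eta (pgen C i j) = 0) -> forall a, eta a = 0.
Proof.
case=> etaL etaM eta0.
pose eL := GRing.isLinear.Build C A 'cV[C]_m.+1 _ eta etaL.
pose e : {linear A -> 'cV[C]_m.+1} := HB.pack eta eL.
have etaD a b : eta (a + b) = eta a + eta b by exact: (raddfD e).
have etaZ c a : eta (c *: a) = c *: eta a by exact: (linearZZ e).
have eta00 : eta 0 = 0 by exact: (raddf0 e).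
have eta1 : eta 1 = 0.
  have := etaM 1 1; rewrite mulr1 (rmorph1 rho) (rmorph1 (counit C n)).
  by rewrite mul1mx scale1r -{1}[eta 1]addr0 => /addrI.
suff H a : eta a = 0 /\ eta (star a) = 0 by move=> a; case: (H a).
move: a; apply: PolSnDef.quotW.
elim=> [i j|||s [fs gs] t [ft gt]|c t [ft gt]|s [fs gs] t [ft gt]|t [ft gt]].
- by case: (pgen_magic C n) => H _ _; case: (H i j) => -> _; rewrite eta0.
- by rewrite -[X in star X]/(0 : A) star0.
- by rewrite -[X in star X]/(1 : A) star1.
- by rewrite PolSnDef.pi_add etaD fs ft starD etaD gs gt addr0.
- by rewrite PolSnDef.pi_scale etaZ ft starZ etaZ gt !scaler0.
- rewrite PolSnDef.pi_mul etaM fs ft starM etaM gs gt.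
  by rewrite !mulmx0 !scaler0 addr0.
- by rewrite PolSnDef.pi_star starK.
Qed.

(** The five hypotheses are what the product rule imposes on the values of a
    cocycle at the two sides of each defining relation.  They suffice because
    they say that the quadruples (rho(p_ij), x_ij, x_ij^*, [i = j]) form a
    magic unitary in [sqz]. *)
Lemma cocycle_of_gens (x : 'I_n -> 'I_n -> 'cV[C]_m.+1) :
  (forall i j, rho (pgen C i j) *m x i j + (i == j)%:R *: x i j = x i j) ->
  (forall i j k, j != k ->
     rho (pgen C i j) *m x i k + (i == k)%:R *: x i j = 0) ->
  (forall i j k, j != k ->
     rho (pgen C j i) *m x k i + (k == i)%:R *: x j i = 0) ->
  (forall i, \sum_j x i j = 0) -> (forall i, \sum_j x j i = 0) ->
  exists2 eta, is_cocycle rho eta & forall i j, eta (pgen C i j) = x i j.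
Proof.
move=> xI xr xc sr sc.
pose q i j : sqz C m := (rho (pgen C i j), x i j, (x i j)^t*, (i == j)%:R).
have rhos i j : star (rho (pgen C i j)) = rho (pgen C i j).
  by case: (pgen_magic C n) => H _ _; rewrite -rmorph_star; case: (H i j) => ->.
have qs i j : star (q i j) = q i j.
  apply: sqzP => //=; [exact: adjmxK | exact: conjC_nat].
(* Row components are the column components of the adjoints, and each relation
   is mapped by star to another one of the same family; so the conditions on x
   give both components. *)
have sqz_star (y z : sqz C m) :
    sqz_mx y = sqz_mx z -> sqz_scal y = sqz_scal z ->
    sqz_col y = sqz_col z -> sqz_col (star y) = sqz_col (star z) -> y = z.
  move=> e1 e2 e3 /(congr1 (fun w => w ^t*)).
  by rewrite /= !adjmxK => e4; apply: sqzP.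
have [pI po ps] := pgen_magic C n.
have [dI dO dS] := PolSnDef.delta_magic C n.
have q_magic : magic_unitary q.
  split=> [i j|i j k jk|i].
  - split=> //; apply: sqz_star.
    + case: (pI i j) => _ E.
      by rewrite [LHS](rmorphM sqz_mx) -[LHS](rmorphM rho) E.
    + by case: (dI i j).
    + exact: xI.
    + by rewrite starM !qs; exact: xI.
  - have mxE0 i1 j1 i2 j2 : pgen C i1 j1 * pgen C i2 j2 = 0 ->
        sqz_mx (q i1 j1 * q i2 j2) = 0.
      move=> e; rewrite [LHS](rmorphM sqz_mx) -[LHS](rmorphM rho) e.
      exact: (raddf0 rho).
    split; apply: sqz_star; rewrite ?starM ?star0 ?qs.
    + by apply: mxE0; case: (po i j k jk).
    + by case: (dO i j k jk).
    + exact: xr.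
    + by apply: xr; rewrite eq_sym.
    + by apply: mxE0; case: (po i j k jk).
    + by case: (dO i j k jk).
    + exact: xc.
    + by apply: xc; rewrite eq_sym.
  - have colS (F : 'I_n -> sqz C m) :
        sqz_col (\sum_j F j) = \sum_j sqz_col (F j).
      by elim/big_rec2: _ => // j y1 y2 _ <-.
    split; apply: sqz_star; rewrite ?star_sum.
    + rewrite raddf_sum /= -(rmorph_sum rho).
      by case: (ps i) => -> _; rewrite rmorph1.
    + by rewrite raddf_sum /=; case: (dS i).
    + by rewrite colS sr.
    + by under eq_bigr do rewrite qs; rewrite colS star1 sr.
    + rewrite raddf_sum /= -(rmorph_sum rho).
      by case: (ps i) => _ ->; rewrite rmorph1.
    + by rewrite raddf_sum /=; case: (dS i).
    + by rewrite colS sc.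
    + by under eq_bigr do rewrite qs; rewrite colS star1 sc.
pose f := pol_lift q_magic.
have fmx a : sqz_mx (f a) = rho a.
  apply: (pol_lift_uniq (f := sqz_mx \o f) (g := rho)) => i j /=.
  by rewrite pol_lift_gen.
have fsc a : sqz_scal (f a) = counit C n a.
  apply: (pol_lift_uniq (f := sqz_scal \o f) (g := counit C n)) => i j /=.
  by rewrite pol_lift_gen counit_gen.
exists (sqz_col \o f); last by move=> i j; rewrite /= pol_lift_gen.
split=> [c a b|a b].
  by rewrite /comp linearP; exact: sqz_col_linear.
by rewrite /comp rmorphM sqz_colM fmx fsc.
Qed.

Lemma cocycle_ext (eta eta' : A -> 'cV[C]_m.+1) :
  is_cocycle rho eta -> is_cocycle rho eta' ->
  (forall i j, eta (pgen C i j) = eta' (pgen C i j)) -> eta =1 eta'.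
Proof.
move=> /asboolP etac /asboolP etac' e a.
apply/eqP; rewrite -subr_eq0; apply/eqP.
have /asboolP dc : eta - eta' \in cocycle rho by rewrite rpredB.
by apply: (cocycle_eq0 dc) => i j; rewrite -[LHS]/(eta _ - eta' _) e subrr.
Qed.

End Cocycles.

(** * Quotients of modules and periodic functions *)

Lemma surjective_quot_iso (R : pzRingType) (V D : lmodType R)
    (W : submodClosed V) (f : {linear V -> D}) :
  (forall v, (v \in W) = (f v == 0)) -> (forall y, exists v, f v = y) ->
  lmod_isomorphic (quot_lmod W) D.
Proof.
move=> kerf surjf.
pose g (x : quot_lmod W) : D := f (repr x).
have gE v : g (quot_pi W v) = f v.
  apply/eqP; rewrite -subr_eq0 -raddfB -kerf; apply/quot_piP.
  exact: reprK.
have piW (x : quot_lmod W) : exists v, x = quot_pi W v.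
  by exists (repr x); rewrite -[LHS]reprK.
have gL : linear g.
  move=> c x y; have [[u ->] [v ->]] := (piW x, piW y).
  by rewrite -linearP !gE linearP.
pose gl := GRing.isLinear.Build R (quot_lmod W) D _ g gL.
pose gh : {linear quot_lmod W -> D} := HB.pack g gl.
exists gh.
pose h y := quot_pi W (sval (cid (surjf y))).
exists h => [x|y].
  have [v ->] := piW x; apply/quot_piP; rewrite kerf raddfB subr_eq0.
  by case: cid => u /= ->; rewrite gE.
by rewrite /h; case: cid => u /= <-; exact: gE.
Qed.

(** By Bezout the multiples of e modulo n.+1 are those of gcd(n.+1, e), so the
    class of j modulo the gcd determines the value at j. *)
Lemma periodic_gcd T n (e : 'I_n.+1) (f : 'I_n.+1 -> T) :
  (forall j, f (j + e) = f j) -> forall j, f j = f (inord (j %% gcdn n.+1 e)).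
Proof.
move=> fe; pose g := gcdn n.+1 e.
pose F k := f (inZp k).
have FZ k l : k = l %[mod n.+1] -> F k = F l.
  by move=> kl; congr f; apply: val_inj.
have Fe k a : F (k + a * e)%N = F k.
  elim: a => [|a IH]; first by rewrite addn0.
  rewrite -IH -[RHS]fe; congr f; apply: val_inj => /=.
  by rewrite modnDml mulSn addnAC addnA.
have Fg k : F (k + g)%N = F k.
  have [a _ /dvdnP[q qE]] := Bezoutl e (ltn0Sn n).
  rewrite -(Fe _ a) -addnA qE; apply: FZ.
  by rewrite addnC modnMDl.
have Fgq k q : F (k + q * g)%N = F k.
  elim: q => [|q IH]; first by rewrite addn0.
  by rewrite mulSn addnCA addnC Fg.
move=> j; transitivity (F j); first by rewrite /F valZpK.
have lt_mod : (j %% g < n.+1)%N by apply: leq_ltn_trans (leq_mod _ _) _.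
rewrite {1}(divn_eq j g) addnC Fgq; congr f; apply: ord_inj.
by rewrite /= (modn_small lt_mod) inordK.
Qed.

(** * Cocycles of a representation diagonal along the translations *)

Section Diagonal.
Variables (C : numClosedFieldType) (n : nat).
Local Notation A := (Pol_Snp C n.+1).
Local Notation p := (pgen C).
Variables (rho : starMorphism A 'M[C]_n.+1) (U : 'M[C]_n.+1).
Hypothesis U_unit : U \in unitmx.
Hypothesis U_rho : forall j k : 'I_n.+1,
  U *m rho (p j k) = delta_mx (j - k) (j - k) *m U.

(** U conjugates rho to diagonal matrices, the diagonal entry of index e being
    the character p_jk |-> [e = j - k]. *)
Definition coord (v : 'cV[C]_n.+1) (e : 'I_n.+1) : C := (U *m v) e 0.

Lemma coord_inj u v : coord u =1 coord v -> u = v.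
Proof.
move=> uv; rewrite -[u](mulKmx U_unit) -[v](mulKmx U_unit); congr (_ *m _).
by apply/matrixP=> e i; rewrite ord1; exact: uv.
Qed.

Lemma coord_of (a : 'I_n.+1 -> C) : exists v, coord v =1 a.
Proof.
by exists (invmx U *m \col_e a e) => e; rewrite /coord mulKVmx // mxE.
Qed.

Lemma coordD u v e : coord (u + v) e = coord u e + coord v e.
Proof. by rewrite /coord mulmxDr mxE. Qed.

Lemma coordZ c v e : coord (c *: v) e = c * coord v e.
Proof. by rewrite /coord -scalemxAr mxE. Qed.

Lemma coord0 e : coord 0 e = 0.
Proof. by rewrite /coord mulmx0 mxE. Qed.

Lemma coord_sum (I : finType) (F : I -> 'cV_n.+1) e :
  coord (\sum_i F i) e = \sum_i coord (F i) e.
Proof. by rewrite /coord mulmx_sumr summxE. Qed.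

Lemma coord_rho j k v e :
  coord (rho (p j k) *m v) e = (e == j - k)%:R * coord v e.
Proof.
rewrite /coord mulmxA U_rho -mulmxA mxE (bigD1 (j - k)) //= big1 => [|i ij].
  by rewrite mxE eqxx andbT addr0; case: eqP => [->|_]; rewrite ?mul0r.
by rewrite mxE (negPf ij) andbF mul0r.
Qed.

Lemma coord_coboundary j k v e :
  coord ((rho (p j k) - (counit C n.+1 (p j k))%:M) *m v) e =
  ((e == j - k)%:R - (j == k)%:R) * coord v e.
Proof.
by rewrite counit_gen mulmxBl mul_scalar_mx -scaleN1r coordD !coordZ coord_rho
  mulN1r mulrBl.
Qed.

Section OneCocycle.
Variable eta : A -> 'cV[C]_n.+1.
Hypothesis eta_cocycle : is_cocycle rho eta.
Local Notation y e j k := (coord (eta (p j k)) e).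

Let eta0 : eta 0 = 0.
Proof.
case: eta_cocycle => etaL _.
by have := etaL (-1) 0 0; rewrite scaler0 addr0 scaleN1r addNr.
Qed.

Let etaM j k j' k' e :
  coord (eta (p j k * p j' k')) e =
  (e == j - k)%:R * y e j' k' + (j' == k')%:R * y e j k.
Proof.
by case: eta_cocycle => _ ->; rewrite counit_gen coordD coordZ coord_rho.
Qed.

Let yI e j k : (e == j - k)%:R * y e j k + (j == k)%:R * y e j k = y e j k.
Proof.
rewrite -etaM; case: (pgen_magic C n.+1) => H _ _.
by case: (H j k) => _ ->.
Qed.

Let y_row e i j k : j != k ->
  (e == i - j)%:R * y e i k + (i == k)%:R * y e i j = 0.
Proof.
rewrite -etaM; case: (pgen_magic C n.+1) => _ H _ jk.
by case: (H i j k jk) => -> _; rewrite eta0 coord0.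
Qed.

Let y_col e i j k : j != k ->
  (e == j - i)%:R * y e k i + (k == i)%:R * y e j i = 0.
Proof.
rewrite -etaM; case: (pgen_magic C n.+1) => _ H _ jk.
by case: (H i j k jk) => _ ->; rewrite eta0 coord0.
Qed.

(** Idempotency kills the entries with k different from j and j - e, and makes
    everything vanish when e = 0; orthogonality of p_jj and p_jk links the two
    surviving entries of each row. *)
Lemma coord_cocycle e j k :
  y e j k = ((j == k)%:R - (e == j - k)%:R) * y e j j.
Proof.
have := yI e j k; have [<-|jk] := eqVneq j k.
  rewrite subrr; case: (e == 0).
    by rewrite !mul1r subrr mul0r -{3}[y e j j]addr0 => /addrI.
  by rewrite subr0 mul1r.
have [ejk _|_] := eqVneq e (j - k).
  have := @y_row e j k j; rewrite eq_sym => /(_ jk).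
  rewrite ejk !eqxx !mul1r => /eqP; rewrite addr_eq0 => /eqP h.
  by rewrite sub0r mulN1r h opprK.
by rewrite !mul0r addr0 => <-; rewrite subrr mul0r.
Qed.

(** For e nonzero, (j + e, j) is the only off-diagonal survivor of its row and
    of its column, hence opposite to both y_(j + e, j + e) and y_(j, j). *)
Lemma coord_cocycle_period e j : y e (j + e) (j + e) = y e j j.
Proof.
have [->|e0] := eqVneq e 0; first by rewrite addr0.
have je : j + e != j by rewrite -subr_eq0 addrAC subrr add0r.
have ej : j + e - j = e by rewrite addrAC subrr add0r.
have := y_col e j je; rewrite (coord_cocycle e (j + e) j) (negPf je) ej !eqxx.
rewrite sub0r mulN1r !mul1r => /eqP.
by rewrite subr_eq0 eq_sym => /eqP.
Qed.

End OneCocycle.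

(** Vanishing for e = 0 is forced: that coordinate carries the counit itself,
    and idempotency of p_jj makes a counit-counit cocycle zero. *)
Lemma periodic_cocycle (a : 'I_n.+1 -> 'I_n.+1 -> C) :
  (forall e j, a e (j + e) = a e j) -> (forall j, a 0 j = 0) ->
  exists2 eta, is_cocycle rho eta &
    forall e j, coord (eta (p j j)) e = a e j.
Proof.
move=> ae a0.
pose b e j k : C := ((j == k)%:R - (e == j - k)%:R) * a e j.
have x_ex j k : exists v, forall e, coord v e = b e j k.
  exact: (coord_of (fun e => b e j k)).
pose x j k := sval (cid (x_ex j k)).
have xE j k e : coord (x j k) e = b e j k by rewrite /x; case: cid.
have coordL j k v u i :
  coord (rho (p j k) *m u + i *: v) = fun e =>
    (e == j - k)%:R * coord u e + i * coord v e.
  by apply/funext=> e; rewrite coordD coordZ coord_rho.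
have [|||||eta etac etaE] := @cocycle_of_gens _ _ _ rho x.
- move=> j k; apply: coord_inj => e; rewrite coordL !xE /b.
  by case: (j == k); case: (e == _);
    rewrite /= ?(subrr, subr0, sub0r) ?(mul0r, mul1r, addr0, add0r, mulr0).
- move=> i j k jk; apply: coord_inj => e; rewrite coordL !xE coord0 /b.
  have [ik|_] := eqVneq i k.
    rewrite ik subrr [k == j]eq_sym (negPf jk) sub0r.
    have [-> |_] := eqVneq e 0; first by rewrite a0 !mulr0 addr0.
    by rewrite subr0 !mul1r mulNr subrr.
  rewrite sub0r mul0r addr0; case: eqP => [->|_]; last by rewrite mul0r.
  by rewrite (inj_eq (addrI i)) eqr_opp (negPf jk) oppr0 mul0r mulr0.
- move=> i j k jk; apply: coord_inj => e; rewrite coordL !xE coord0 /b.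
  have [ki|_] := eqVneq k i.
    rewrite -{}ki in jk *; rewrite (negPf jk) subrr sub0r.
    have [->|_] := eqVneq e 0; first by rewrite !a0 !mulr0 addr0.
    case: eqP => [ejk|_]; last by rewrite mul0r oppr0 mul0r mulr0 addr0.
    by rewrite subr0 !mul1r mulN1r -(ae e k) ejk subrKC subrr.
  rewrite sub0r mul0r addr0; case: eqP => [->|_]; last by rewrite mul0r.
  by rewrite (inj_eq (addIr _)) (negPf jk) oppr0 mul0r mulr0.
- move=> i; apply: coord_inj => e; rewrite coord_sum coord0.
  under eq_bigr do rewrite xE /b.
  rewrite -mulr_suml sumrB (bigD1 i) //= [X in _ - X](bigD1 (i - e)) //=.
  rewrite eqxx subKr eqxx.
  rewrite !big1 ?addr0 ?subrr ?mul0r // => j ji.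
    by case: eqP => // ej; rewrite ej subKr eqxx in ji.
  by rewrite eq_sym (negPf ji).
- move=> i; apply: coord_inj => e; rewrite coord_sum coord0.
  under eq_bigr do rewrite xE /b mulrBl.
  have ei : i + e - i = e by rewrite addrAC subrr add0r.
  rewrite sumrB (bigD1 i) //= [X in _ - X](bigD1 (i + e)) //= ei !eqxx.
  rewrite !big1 ?addr0 ?mul1r ?ae ?subrr // => j ji; last first.
    by rewrite (negPf ji) mul0r.
  by case: eqP => [ej|_]; [rewrite ej subrKC eqxx in ji | rewrite mul0r].
exists eta => // e j; rewrite etaE xE /b eqxx subrr.
by case: eqP => [->|_]; rewrite ?a0 ?mulr0 // subr0 mul1r.
Qed.

(** Index k stands for the coordinate e = k.+1, and r for the representative
    r.+1 of a nonzero class modulo gcd(n.+1, e). *)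
Definition jumps (eta : Z1 rho) :
    dirsum (fun k : 'I_n => 'rV[C]_(gcdn n.+1 k.+1 - 1) : lmodType C) :=
  [ffun k => \row_r
     (coord (val eta (p (inord r.+1) (inord r.+1))) (lift ord0 k) -
      coord (val eta (p 0 0)) (lift ord0 k))].

Fact jumps_linear : linear jumps.
Proof.
move=> c f g; apply/ffunP=> k; rewrite !ffunE; apply/matrixP=> i r.
by rewrite !mxE !coordD !coordZ mulrBr opprD addrACA.
Qed.
HB.instance Definition _ := GRing.isLinear.Build C _ _ _ jumps jumps_linear.

Lemma lift0_gcd (k : 'I_n) : gcdn n.+1 (lift ord0 k) = gcdn n.+1 k.+1.
Proof. by []. Qed.

(** Vanishing jumps make the diagonal values constant in j, and the cocycle then
    agrees on generators with the coboundary of the vector whose coordinates are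
    the opposite constants. *)
Lemma jumps_ker (eta : Z1 rho) : (eta \in B1 rho) = (jumps eta == 0).
Proof.
have etac : is_cocycle rho (val eta) by exact/asboolP/(valP eta).
apply/asboolP/eqP => [[v etaE]|/ffunP jump0].
  apply/ffunP=> k; rewrite !ffunE; apply/matrixP=> i r.
  by rewrite !mxE !etaE !coord_coboundary !subrr !eqxx subrr.
have const k j : coord (val eta (p j j)) (lift ord0 k) =
                 coord (val eta (p 0 0)) (lift ord0 k).
  rewrite (periodic_gcd (f := fun j => coord (val eta (p j j)) (lift ord0 k))
    (coord_cocycle_period etac _)) lift0_gcd.
  set g := gcdn _ _; have g_gt0 : (0 < g)%N by rewrite gcdn_gt0.
  have : (j %% g < g)%N by rewrite ltn_mod.
  case: (j %% g)%N => [_|r r_lt].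
    have -> // : inord 0 = 0 :> 'I_n.+1 by apply: ord_inj; rewrite inordK.
  have r_lt' : (r < g - 1)%N by rewrite ltn_subRL.
  have /matrixP/(_ 0 (Ordinal r_lt')) := jump0 k; rewrite !ffunE !mxE /=.
  by move/eqP; rewrite subr_eq0 => /eqP.
have [v vE] := coord_of (fun e => - coord (val eta (p 0 0)) e).
have cob : is_cocycle rho (fun a => (rho a - (counit C n.+1 a)%:M) *m v).
  by apply: coboundary_cocycle; exists v.
exists v; apply: (cocycle_ext etac cob) => j k; apply: coord_inj => e.
rewrite coord_coboundary vE (coord_cocycle etac) mulrN -mulNr opprB.
case: (unliftP ord0 e) => [l ->|->]; first by rewrite const.
by rewrite [ord0 == _]eq_sym subr_eq0 subrr !mul0r.
Qed.

(** Given the jumps, the diagonal values can be normalised to vanish on the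
    class of 0; the sum over r that extends them periodically has at most one
    term. *)
Lemma jumps_surj y : exists eta, jumps eta = y.
Proof.
pose a (e j : 'I_n.+1) : C :=
  if unlift ord0 e is Some k then
    \sum_(r < gcdn n.+1 k.+1 - 1 | r.+1 == (j %% gcdn n.+1 k.+1)%N) y k 0 r
  else 0.
have [||eta etac etaE] := @periodic_cocycle a.
- move=> e j; rewrite /a; case: unliftP => // k ek.
  suff -> : ((j + e)%R %% gcdn n.+1 k.+1)%N = (j %% gcdn n.+1 k.+1)%N by [].
  rewrite /= modn_dvdm ?dvdn_gcdl // ek -modnDmr.
  by rewrite [(lift _ _ %% _)%N](eqP (dvdn_gcdr n.+1 k.+1)) addn0.
- by move=> j; rewrite /a unlift_none.
have etaZ : cocycle rho eta by exact/asboolP.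
exists (Sub eta etaZ); apply/ffunP=> k; rewrite ffunE; apply/matrixP=> i r.
rewrite SubK !mxE !etaE /a liftK ord1.
set g := gcdn _ _ in r *.
have r_lt : (r.+1 < g)%N by move: (ltn_ord r); rewrite ltn_subRL add1n.
rewrite inordK; last first.
  by apply: (leq_trans r_lt); rewrite dvdn_leq // dvdn_gcdl.
rewrite modn_small // (big_pred1 r) // mod0n big_pred0 // ?subr0 //.
Qed.

End Diagonal.

(** * The Fourier representation *)

Section Fourier.
Variables (R : realType) (n : nat).
Local Notation C := (R[i]).
Local Notation F := (fourier_mx R n).

Lemma expiD (s t : R) : expi (s + t) = expi s * expi t.
Proof.
rewrite /expi cosD sinD; apply/eqP; rewrite eq_complex /=.
by rewrite eqxx [cos s * sin t + _]addrC eqxx.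
Qed.

Lemma expiMn (t : R) m : expi (t * m%:R) = expi t ^+ m.
Proof.
elim: m => [|m IH]; first by rewrite mulr0 /expi cos0 sin0.
by rewrite -natr1 mulrDr mulr1 expiD IH exprSr.
Qed.

Lemma fourier_row_add (j k m : 'I_n.+1) : F (j + k) m = F j m * F k m.
Proof.
pose z := expi (2 * pi / n.+1%:R : R).
have N0 : n.+1%:R != 0 :> R by rewrite pnatr_eq0.
have zN : z ^+ n.+1 = 1.
  rewrite -expiMn divfK // /expi mulr_natl cos2pi sin2pi //.
have FE l : F l m = z ^+ m ^+ l.
  rewrite mxE -exprM -expiMn natrM; congr expi; field.
  by rewrite nat1r.
rewrite !FE -exprD /= expr_mod // -exprM mulnC exprM zN expr1n //.
Qed.

Lemma row_quotient_fourier (j k : 'I_n.+1) :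
  row_quotient F j k = col (j - k) F^T.
Proof.
have F0 l m : F l m != 0.
  apply/eqP=> Fl0; have := @fourier_unimodular R n l m.
  by rewrite Fl0 mul0r => /esym/eqP; rewrite oner_eq0.
apply/matrixP=> m i; rewrite [LHS]mxE [RHS]mxE [RHS]mxE.
by rewrite -{1}(subrK k j) (fourier_row_add (j - k)) mulfK.
Qed.

(** Up to the factor n.+1, the change of basis to the rows of F. *)
Definition dft_mx : 'M[C]_n.+1 := map_mx Num.conj F.

Lemma dft_mul : dft_mx *m F^T = n.+1%:R%:M.
Proof.
by rewrite -[RHS]tr_scalar_mx -fourier_hadamard trmx_mul -map_trmx trmxK.
Qed.

Lemma dft_unit : dft_mx \in unitmx.
Proof.
have N0 : n.+1%:R != 0 :> C by rewrite pnatr_eq0.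
have /mulmx1_unit[] // : dft_mx *m (n.+1%:R^-1 *: F^T) = 1%:M.
by rewrite -scalemxAr dft_mul scale_scalar_mx mulVf.
Qed.

Lemma dft_rho (j k : 'I_n.+1) :
  dft_mx *m rho_fourier R n (pgen C j k) = delta_mx (j - k) (j - k) *m dft_mx.
Proof.
have N0 : n.+1%:R != 0 :> C by rewrite pnatr_eq0.
rewrite rho_fourier_gen row_quotient_fourier; set d := j - k.
have adj_col : (col d F^T) ^t* = row d dft_mx.
  by apply/matrixP=> a b; rewrite !mxE.
have dft_col : dft_mx *m col d F^T = n.+1%:R *: delta_mx d 0.
  by rewrite colE mulmxA dft_mul mul_scalar_mx.
have nrm : ((col d F^T) ^t* *m col d F^T) 0 0 = n.+1%:R.
  by rewrite adj_col -row_mul dft_col !mxE !eqxx mulr1.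
rewrite /Proj nrm -scalemxAr mulmxA dft_col adj_col rowE mulmxA.
by rewrite -scalemxAl mul_delta_mx -scalemxAl scalerA mulVf ?scale1r.
Qed.
End Fourier.

(** * First cohomology *)

Theorem proposition9p2 (R : realType) :
  (forall n : nat,
     lmod_isomorphic
       (H1 (rho_fourier R n))
       (dirsum (fun k : 'I_n =>
          'rV[R[i]]_(gcdn n.+1 k.+1 - 1)%N : lmodType R[i])))
  /\
  (forall n : nat, prime n.+1 ->
     (forall x : H1 (rho_fourier R n), x = 0) /\
     (forall eta : Pol_Snp R[i] n.+1 -> 'cV[R[i]]_n.+1,
        is_cocycle (rho_fourier R n) eta ->
        is_coboundary (rho_fourier R n) eta)).
Proof.
split=> [n|n n_prime].
  apply: (surjective_quot_iso (f := jumps (dft_mx R n))).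
    exact: (jumps_ker (dft_unit R n) (@dft_rho R n)).
  exact: (jumps_surj (dft_unit R n) (@dft_rho R n)).
have all_B1 (eta : Z1 (rho_fourier R n)) : eta \in B1 (rho_fourier R n).
  rewrite (jumps_ker (dft_unit R n) (@dft_rho R n)); apply/eqP/ffunP=> k.
  (* gcd(n.+1, k.+1) = 1, so the row of jumps has length 0 *)
  apply/matrixP=> i [r r_lt]; exfalso; move: r_lt.
  have /eqP -> : coprime n.+1 k.+1; last by [].
  by rewrite prime_coprime // gtnNdvd // ltnS ltn_ord.
split=> [x|eta etac].
  rewrite -[x]reprK -(raddf0 (quot_pi (B1 (rho_fourier R n)))).
  by apply/quot_piP; exact: all_B1.
have etaZ : cocycle (rho_fourier R n) eta by exact/asboolP.
by have /asboolP := all_B1 (Sub eta etaZ).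
Qed.
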